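(* Let $\Bbbk$ be a field and let $G$ be a finite, simple, connected, nontrivial graph on vertex set $\{1,\ldots,n\}$ with edge ideal $I(G)\subseteq S=\Bbbk[x_1,\ldots,x_n]$. If $I(G)$ is Gorenstein (that is, $S/I(G)$ is a Gorenstein ring), then the LCM lattice $\mathcal{L}_{I(G)}$ is coatomic.
   Context: A graph is nontrivial if it has at least one edge. $I(G)=(x_ix_j\mid\{i,j\}\in E(G))$. The LCM lattice $\mathcal{L}_I$ of a monomial ideal $I$ is the set of least common multiples of subsets of its minimal monomial generators (the lcm of the empty set is $1$), ordered by divisibility; it is a finite lattice with join lcm. In a finite lattice a coatom is an element covered by $\hat 1$; the lattice is coatomic if every element is a (possibly empty) meet of coatoms. *)

(* Defs.v *)
From HB Require Import structures.
From mathcomp Require Import all_boot all_order all_algebra.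
From mathcomp Require Import ring_quotient.
From mathcomp Require Import mpoly.
From mathcomp Require Import boolp.

Set Implicit Arguments.
Unset Strict Implicit.
Unset Printing Implicit Defensive.

Import GRing.Theory.
Local Open Scope ring_scope.

Section Ideals.
Variable R : comNzRingType.

Definition is_ideal (I : R -> Prop) : Prop :=
  [/\ I 0, forall x y, I x -> I y -> I (x + y) & forall a x, I x -> I (a * x)].

Definition generated_ideal (P : R -> Prop) (x : R) : Prop :=
  exists s : seq (R * R),
    (forall c, c \in s -> P c.2) /\ x = \sum_(c <- s) c.1 * c.2.

Definition noetherian : Prop :=
  forall I, is_ideal I ->
    exists gens : seq R, forall x, I x <-> generated_ideal (fun y => y \in gens) x.

Definition maximal_ideal (m : R -> Prop) : Prop :=
  [/\ is_ideal m, ~ m 1 &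
      forall J, is_ideal J -> (forall x, m x -> J x) -> ~ J 1 ->
        forall x, J x -> m x].

(* [phi] exhibits [A] as the localization of [R] at [m]; this determines [A]
   up to a unique isomorphism of [R]-algebras. *)
Definition is_localization_at (m : R -> Prop) (A : comNzRingType)
    (phi : {rmorphism R -> A}) : Prop :=
  [/\ forall s, ~ m s -> exists t, phi s * t = 1,
      forall a, exists r s, ~ m s /\ a * phi s = phi r &
      forall r, phi r = 0 -> exists s, ~ m s /\ s * r = 0].

Definition injective_module (E : lmodType R) : Prop :=
  forall (M N : lmodType R) (f : {linear M -> N}) (g : {linear M -> E}),
    injective f -> exists h : {linear N -> E}, forall x, h (f x) = g x.

(* There is an exact sequence 0 -> M -> E 0 -> E 1 -> ... -> E d -> 0
   with every E i injective. *)
Definition finite_injective_dimension (M : lmodType R) : Prop :=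
  exists (d : nat) (E : nat -> lmodType R) (eps : {linear M -> E 0%N})
         (delta : forall i, {linear E i -> E i.+1}),
    [/\ forall i, injective_module (E i),
        injective eps,
        forall y, delta 0%N y = 0 <-> exists x, eps x = y,
        forall i y, delta i.+1 y = 0 <-> exists x, delta i x = y &
        forall i, (d < i)%N -> forall y : E i, y = 0].

End Ideals.

(* A ring is Gorenstein if it is Noetherian and its localization at each
   maximal ideal has finite injective dimension as a module over itself. *)
Definition gorenstein (R : comNzRingType) : Prop :=
  noetherian R /\
  forall m : R -> Prop, maximal_ideal m ->
    exists (A : comNzRingType) (phi : {rmorphism R -> A}),
      is_localization_at m phi /\ finite_injective_dimension A^o.

Section EdgeIdeal.
Variables (k : fieldType) (n : nat) (e : rel 'I_n).

Definition edge_monomial (f : {mpoly k[n]}) : Prop :=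
  exists i j, e i j /\ f = 'X_i * 'X_j.

Definition edge_ideal : pred {mpoly k[n]} :=
  fun f => `[< generated_ideal edge_monomial f >].

Lemma edge_idealP f : reflect (generated_ideal edge_monomial f) (f \in edge_ideal).
Proof. exact: asboolP. Qed.

Fact edge_ideal_closed : idealr_closed edge_ideal.
Proof.
split=> [||a u v /edge_idealP[s [Ps ->]] /edge_idealP[t [Pt ->]]].
- by apply/edge_idealP; exists [::]; rewrite big_nil.
- apply/negP => /edge_idealP[s [Ps /(congr1 (mcoeff 0%MM))]].
  rewrite mcoeff1 eqxx raddf_sum big1_seq => [/eqP|c /= /Ps [i [j [_ ->]]]].
    by rewrite oner_eq0.
  by rewrite !rmorphM /= mcoeffX mnm1_eq0 mul0r mulr0.
apply/edge_idealP; exists ([seq (a * c.1, c.2) | c <- s] ++ t); split.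
  move=> c; rewrite mem_cat => /orP[/mapP[b /Ps Pb ->]|/Pt] //.
rewrite big_cat big_map /= mulr_sumr; congr (_ + _).
by apply: eq_bigr => c _; rewrite mulrA.
Qed.

HB.instance Definition _ :=
  isIdealr.Build {mpoly k[n]} edge_ideal edge_ideal_closed.

Definition edge_ideal_quotient : comNzRingType :=
  {ideal_quot (edge_ideal : idealr {mpoly k[n]})}.

End EdgeIdeal.

Arguments edge_ideal k {n} e.
Arguments edge_ideal_quotient k {n} e.

Section LcmLattice.
Variables (k : fieldType) (n : nat) (I : pred {mpoly k[n]}).

Definition minimal_monomial_generator (g : 'X_{1..n}) : Prop :=
  'X_[g] \in I /\ forall m : 'X_{1..n}, 'X_[m] \in I -> (m <= g)%MM -> m = g.

Definition lcm_lattice (m : 'X_{1..n}) : Prop :=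
  exists s : seq 'X_{1..n},
    (forall g, g \in s -> minimal_monomial_generator g) /\
    m = \big[@mlcm n/0%MM]_(g <- s) g.

End LcmLattice.

(* Subsets [L] of a type [T], ordered by the restriction of [le]. *)
Section Coatomic.
Variables (T : Type) (le : rel T) (L : T -> Prop).

Definition is_top (t : T) : Prop := L t /\ forall x, L x -> le x t.

Definition covered_by (x y : T) : Prop :=
  [/\ L x, L y, le x y, x <> y &
      forall z, L z -> le x z -> le z y -> z = x \/ z = y].

Definition coatom (x : T) : Prop := exists2 t, is_top t & covered_by x t.

(* With [C] empty, the meet is the top element. *)
Definition is_meet (C : T -> Prop) (x : T) : Prop :=
  [/\ L x, forall c, C c -> le x c &
      forall z, L z -> (forall c, C c -> le z c) -> le z x].

Definition coatomic : Prop :=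
  forall x, L x ->
    exists2 C : T -> Prop, (forall c, C c -> coatom c) & is_meet C x.

End Coatomic.

(* Main.v *)
(* If the edge ideal is Gorenstein and some vertex [w] has a single neighbour
   [v], then [v] has no neighbour other than [w].  Then either the graph is a
   single edge, or every vertex has degree at least 2 and the coatoms of the
   lattice are exactly the products of all variables but one; both lattices are
   coatomic.

   Let [A] be the localization of [k[x]/I(G)] at the origin, [M] the ideal
   [(v)], isomorphic to [A/(N(v))] because [N(v)] generates the annihilator of
   [v], and [K] the module of relations [sum a_x x = 0] between the elements [x] of [N(v)],
   i.e. the second syzygy of [M].  As [w] is a leaf, [v a_w] lies in [(v^2)] for
   every [a] in [K], and taking the [(v)]-component of [a_w] makes [(v) e_w], a
   copy of [M], a direct summand of [K].  So [Ext^i(M, -)] is a direct summand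
   of [Ext^(i+2)(M, -)] for [i > 0], and finite injective dimension of [A] forces
   [Ext^i(M, A) = 0] for all [i > 0].  Hence the projection [K -> (v)] is
   [a |-> sum a_x c_x] for some [c_x] in [A].  Applied to [v e_w] and to
   [u e_w - w e_u], for another neighbour [u] of [v], this gives [v c_w = v] and
   [u c_w = w c_u]: the first makes [c_w] a unit, the second a non-unit. *)
From HB Require Import structures.
Require Import Defs.
From mathcomp Require Import all_boot all_order all_algebra.
From mathcomp Require Import ring_quotient boolp ring.
From mathcomp Require Import mpoly.

Set Implicit Arguments.
Unset Strict Implicit.
Unset Printing Implicit Defensive.

Import GRing.Theory.
Local Open Scope ring_scope.

(** * Extending linear maps from submodules into injective modules *)

Section InjectiveExtension.
Variables (A : comNzRingType) (N : lmodType A).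

Record submodule := Submodule {
  submod_pred :> N -> Prop;
  submod_pred0 : submod_pred 0;
  submod_predZD : forall a x y,
    submod_pred x -> submod_pred y -> submod_pred (a *: x + y) }.

Definition in_submod (P : submodule) : {pred N} := fun x => `[< P x >].

Fact in_submod_closed P : submod_closed (in_submod P).
Proof.
split=> [|a x y /asboolP Px /asboolP Py]; apply/asboolP.
  exact: submod_pred0.
exact: submod_predZD.
Qed.

HB.instance Definition _ P :=
  GRing.isSubmodClosed.Build A N (in_submod P) (in_submod_closed P).

Definition submod_type (P : submodule) := {x : N | x \in in_submod P}.

HB.instance Definition _ P := SubChoice.on (submod_type P).
HB.instance Definition _ P :=
  [SubChoice_isSubLmodule of submod_type P by <:].

(** Packing [P] as a module makes its inclusion an injective linear map. Asking linearity of [g] on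
    [P] alone lets [g] be built from arbitrary choices elsewhere. *)
Lemma injective_extend (E : lmodType A) (P : submodule) (g : N -> E) :
  injective_module E ->
  (forall a x y, P x -> P y -> g (a *: x + y) = a *: g x + g y) ->
  exists h : {linear N -> E}, forall x, P x -> h x = g x.
Proof.
move=> injE glin.
have Pval (x : submod_type P) : P (val x) by apply/asboolP; case: x.
pose gs (x : submod_type P) := g (val x).
have gsl : linear gs.
  move=> a x y; rewrite /gs raddfD /=.
  exact: (glin a _ _ (Pval x) (Pval y)).
pose ghb := GRing.isLinear.Build _ _ _ _ gs gsl.
pose gl : {linear submod_type P -> E} := HB.pack gs ghb.
pose incl := GRing.Linear.clone _ _ _ _ (val : submod_type P -> N) _.
have [h hE] := injE _ _ incl gl val_inj.
exists h => x Px.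
have Px' : x \in in_submod P by apply/asboolP.
exact: (hE (Sub x Px')).
Qed.

End InjectiveExtension.

(** * Vanishing of Ext for [A/(l)], expressed with syzygies *)

Section Syzygies.
Variables (A : comNzRingType) (n : nat) (v : A) (l : 'I_n -> A) (w : 'I_n).

Definition syzygy (a : {ffun 'I_n -> A^o}) : Prop := \sum_i a i * l i = 0.

Definition in_span (x : A) : Prop :=
  exists a : {ffun 'I_n -> A^o}, x = \sum_i a i * l i.

Fact syzygy0 : syzygy 0.
Proof. by rewrite /syzygy big1 // => i _; rewrite ffunE mul0r. Qed.

Lemma sum_ffunZD (c : A) (a b : {ffun 'I_n -> A^o}) (f : 'I_n -> A) :
  \sum_i (c *: a + b) i * f i = c * (\sum_i a i * f i) + \sum_i b i * f i.
Proof.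
rewrite mulr_sumr -big_split /=; apply: eq_bigr => i _.
by rewrite !ffunE mulrDl -mulrA.
Qed.

Fact syzygyZD c a b : syzygy a -> syzygy b -> syzygy (c *: a + b).
Proof.
by rewrite /syzygy sum_ffunZD => -> ->; rewrite mulr0 addr0.
Qed.

Definition syzygies := Submodule syzygy0 syzygyZD.

Fact in_span0 : in_span (0 : A^o).
Proof. by exists 0; rewrite big1 // => i _; rewrite ffunE mul0r. Qed.

Fact in_spanZD (c : A) (x y : A^o) :
  in_span x -> in_span y -> in_span (c *: x + y).
Proof.
by case=> a -> [b ->]; exists (c *: a + b); rewrite sum_ffunZD.
Qed.

Definition span_submod : submodule A^o := Submodule in_span0 in_spanZD.

(* For [Z] a submodule of [E], [ext1_zero Z] and [ext2_zero Z] say that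
   [Ext^1(A/(l), Z)] and [Ext^2(A/(l), Z)] vanish: [z] is a map from the ideal
   [(l)] given by the images of the [l i], [phi] a map from its syzygies. *)
Definition ext1_zero (E : lmodType A) (Z : E -> Prop) : Prop :=
  forall z : 'I_n -> E, (forall i, Z (z i)) ->
    (forall a, syzygy a -> \sum_i (a i : A) *: z i = 0) ->
    exists2 y, Z y & forall i, z i = l i *: y.

Definition ext2_zero (E : lmodType A) (Z : E -> Prop) : Prop :=
  forall phi : {ffun 'I_n -> A^o} -> E,
    (forall c a b, syzygy a -> syzygy b ->
       phi (c *: a + b) = c *: phi a + phi b) ->
    (forall a, syzygy a -> Z (phi a)) ->
    exists2 z : 'I_n -> E, (forall i, Z (z i)) &
      forall a, syzygy a -> phi a = \sum_i (a i : A) *: z i.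

(** The syzygy condition makes [l i |-> z i] a well-defined map on the ideal [(l)]; [y] is the value
    at 1 of an extension to [A]. *)
Lemma injective_ext1_zero (E : lmodType A) (z : 'I_n -> E) :
  injective_module E ->
  (forall a, syzygy a -> \sum_i (a i : A) *: z i = 0) ->
  exists y, forall i, z i = l i *: y.
Proof.
move=> injE zK.
have /choice[al alE] : forall x : A, exists a : {ffun 'I_n -> A^o},
    in_span x -> x = \sum_i a i * l i.
  move=> x; have [[a xE]|nx] := pselect (in_span x); first by exists a.
  by exists 0 => /nx.
have sumZD c (a b : {ffun 'I_n -> A^o}) :
    \sum_i ((c *: a + b) i : A) *: z i =
    c *: (\sum_i (a i : A) *: z i) + \sum_i (b i : A) *: z i.
  rewrite scaler_sumr -big_split /=; apply: eq_bigr => i _.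
  by rewrite !ffunE scalerDl scalerA.
(* Two expressions of the same element differ by a syzygy. *)
have wd (a b : {ffun 'I_n -> A^o}) : \sum_i a i * l i = \sum_i b i * l i ->
    \sum_i (a i : A) *: z i = \sum_i (b i : A) *: z i.
  move=> ab; apply: subr0_eq.
  rewrite addrC -scaleN1r -sumZD; apply: zK.
  by rewrite /syzygy sum_ffunZD mulN1r addrC ab subrr.
have glin (c : A) (x y : A^o) : span_submod x -> span_submod y ->
    \sum_i (al (c *: x + y) i : A) *: z i =
    c *: (\sum_i (al x i : A) *: z i) + \sum_i (al y i : A) *: z i.
  move=> Px Py; rewrite -sumZD; apply: wd.
  rewrite sum_ffunZD -!alE //; exact: in_spanZD.
have [h hE] := @injective_extend A A^o E span_submod
  (fun x => \sum_i (al x i : A) *: z i) injE glin.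
exists (h 1) => i; rewrite -linearZ /=.
pose d : {ffun 'I_n -> A^o} := [ffun j => (j == i)%:R].
have dE : l i = \sum_j d j * l j.
  rewrite (bigD1 i) //= ffunE eqxx mul1r big1 ?addr0 // => j /negPf ji.
  by rewrite ffunE ji mul0r.
have li : in_span (l i) by exists d.
rewrite [_ *: 1]mulr1 hE // (wd _ d) -?alE -?dE //.
rewrite (bigD1 i) //= ffunE eqxx scale1r big1 ?addr0 // => j /negPf ji.
by rewrite ffunE ji scale0r.
Qed.

(** With [annv], this makes [(l)] the annihilator of [v], so [(v)] is a copy of [A/(l)]. By
    [v_reduced], [v ^+ 2 * b] determines [v * b]. *)
Hypothesis vl0 : forall i, v * l i = 0.
Hypothesis v_reduced : forall b, v ^+ 2 * b = 0 -> v * b = 0.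
Hypothesis annv : forall b, v * b = 0 -> in_span b.
Hypothesis syzygy_w :
  forall a, syzygy a -> exists b, v * a w = v ^+ 2 * b.

Let e_w : {ffun 'I_n -> A^o} := [ffun j => (j == w)%:R * v].

Let sum_e_w (E : lmodType A) (z : 'I_n -> E) :
  \sum_i (e_w i : A) *: z i = v *: z w.
Proof.
rewrite (bigD1 w) //= ffunE eqxx mul1r big1 ?addr0 // => j /negPf jw.
by rewrite ffunE jw mul0r scale0r.
Qed.

Let syzygy_e_w : syzygy e_w.
Proof. by rewrite /syzygy -[RHS](vl0 w); exact: (@sum_e_w A^o l). Qed.

(* [Ext^2(-, ker delta) = Ext^1(-, Z')], and [Ext^1(-, ker delta)] embeds into
   [Ext^3(-, ker delta) = Ext^2(-, Z')] through the syzygy [e_w]. *)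
Lemma ext_zero_step (E E' : lmodType A) (delta : {linear E -> E'})
    (Z' : E' -> Prop) :
  injective_module E -> (forall y, Z' y <-> exists x, delta x = y) ->
  ext1_zero Z' -> ext2_zero Z' ->
  ext1_zero (fun x => delta x = 0) /\ ext2_zero (fun x => delta x = 0).
Proof.
move=> injE Z'E x1 x2.
have Z'd x : Z' (delta x) by apply/Z'E; exists x.
split=> [z dz zK|phi philin dphi].
  have [y0 y0E] := injective_ext1_zero injE zK.
  have /choice[be beE] : forall a : {ffun 'I_n -> A^o}, exists b : A,
      syzygy a -> v * a w = v ^+ 2 * b.
    move=> a; have [/syzygy_w[b]|na] := pselect (syzygy a); first by exists b.
    by exists 0.
  have ld i : l i *: delta y0 = 0 by rewrite -linearZ /= -y0E dz.
  (* The difference [b - c] is killed by [v], so it lies in [(l)], which kills [delta y0]. *)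
  have kill b c : v ^+ 2 * b = v ^+ 2 * c -> b *: delta y0 = c *: delta y0.
    move=> bc; apply: subr0_eq; rewrite -scalerBl.
    have [|a ->] := annv (v_reduced (b := b - c) _).
      by rewrite mulrBr bc subrr.
    rewrite scaler_suml big1 // => i _.
    by rewrite -scalerA ld scaler0.
  (* By [kill], this map is linear on syzygies whatever choices [be] makes. *)
  have [c a b sa sb|a sa|z' z'Z z'E] := x2 (fun a => be a *: delta y0).
  - rewrite scalerA -scalerDl; apply: kill.
    rewrite -beE ?mulrDr; last exact: syzygyZD.
    by rewrite !ffunE mulrDr -beE // [c *: _]/(c * _) !(mulrCA _ c) -beE.
  - by rewrite -linearZ.
  have /Z'E[y yE] := z'Z w.
  have := z'E _ syzygy_e_w; rewrite sum_e_w => eE.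
  (* On [e_w] the quotient [be] can be replaced by 1, since [v * v = v ^+ 2 * 1]. *)
  have {}eE : delta y0 = v *: z' w.
    rewrite -eE -[LHS]scale1r; apply: kill.
    by rewrite -beE // ffunE eqxx mul1r mulr1.
  (* The correction moves [y0] into the kernel; as [v * l i = 0], it does not change [l i *: y0]. *)
  exists (y0 - v *: y); first by rewrite linearB linearZ /= yE eE subrr.
  by move=> i; rewrite scalerBr -y0E scalerA mulrC vl0 scale0r subr0.
(* Extend [phi] to the free module. Its basis values may leave the kernel of [delta]; [x1] corrects
   them by multiples [l i *: y], whose total on a syzygy is 0. *)
have [h hE] := @injective_extend A _ E syzygies phi injE philin.
pose d i : {ffun 'I_n -> A^o} := [ffun j => (j == i)%:R].
have hd (a : {ffun 'I_n -> A^o}) : h a = \sum_i (a i : A) *: h (d i).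
  have {1}-> : a = \sum_i (a i : A) *: d i.
    apply/ffunP => j; rewrite sum_ffunE (bigD1 j) //= !ffunE eqxx.
    rewrite big1 ?addr0 => [|i /negPf ij]; first by rewrite [_ *: _]mulr1.
    by rewrite !ffunE eq_sym ij scaler0.
  by rewrite linear_sum; apply: eq_bigr => i _; rewrite linearZ.
have [a sa|y' /Z'E[y <-] y'E] := x1 (fun i => delta (h (d i))) (fun i => Z'd _).
  under eq_bigr do rewrite -linearZ.
  by rewrite -linear_sum /= -hd hE // dphi.
exists (fun i => h (d i) - l i *: y) => [i|a sa].
  by rewrite linearB linearZ /= y'E subrr.
transitivity (\sum_i ((a i : A) *: h (d i) - (a i * l i : A) *: y)).
  by rewrite sumrB -scaler_suml sa scale0r subr0 -hd hE.
by apply: eq_bigr => i _; rewrite scalerBr scalerA.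
Qed.

(** Vanishing starts past the end of the resolution and descends by [ext_zero_step] to
    [ker (delta 0)], a copy of [A]. There it applies to the projection from the syzygies to
    [(v)]. *)
Lemma finite_injective_dimension_syzygy :
  finite_injective_dimension A^o ->
  exists c : 'I_n -> A, forall a b, syzygy a -> v * a w = v ^+ 2 * b ->
    v * b = \sum_i a i * c i.
Proof.
case=> d [E [eps [delta [injE eps_inj ex0 exS E0]]]].
have E_last (y : E d.+1) : y = 0 by apply: E0.
(* [m] counts the steps down from [d.+1], where the module is zero. *)
have key m : forall j, (m + j)%N = d.+1 ->
    ext1_zero (fun x => delta j x = 0) /\ ext2_zero (fun x => delta j x = 0).
  elim: m => [j j_def|m IH j mj].
    rewrite add0n in j_def; subst j; split=> [z dz _|phi _ _].
      by exists 0 => [|i]; [exact: linear0 | rewrite [LHS]E_last [RHS]E_last].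
    exists (fun=> 0) => [i|a _]; first exact: linear0.
    by rewrite [LHS]E_last [RHS]E_last.
  have [|x1 x2] := IH j.+1; first by rewrite addnS.
  by apply: ext_zero_step x1 x2 => //; apply: exS.
have [_ x2] := key d.+1 0%N (addn0 _).
have /choice[be beE] : forall a : {ffun 'I_n -> A^o}, exists b : A,
    syzygy a -> v * a w = v ^+ 2 * b.
  move=> a; have [/syzygy_w[b]|na] := pselect (syzygy a); first by exists b.
  by exists 0.
have inj2 b c : v ^+ 2 * b = v ^+ 2 * c -> v * b = v * c.
  move=> bc; apply: subr0_eq; rewrite -mulrBr.
  by apply: v_reduced; rewrite mulrBr bc subrr.
have [c a b sa sb|a sa|z zE xE] := x2 (fun a => eps (v * be a)).
- rewrite -linearP /=; congr (eps _).
  transitivity (v * (c * be a + be b)); last by rewrite mulrDr mulrCA.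
  apply: inj2; rewrite -beE ?mulrDr; last exact: syzygyZD.
  by rewrite !ffunE mulrDr -beE // [c *: _]/(c * _) !(mulrCA _ c) -beE.
- by apply/ex0; exists (v * be a).
have /choice[c cE] : forall i, exists c : A, eps c = z i.
  by move=> i; have /ex0[] := zE i => c; exists c.
exists c => a b sa ab; rewrite (inj2 b (be a)) -?beE //; apply: eps_inj.
rewrite xE // linear_sum /=; apply: eq_bigr => i _.
by rewrite -cE -linearZ.
Qed.

End Syzygies.

(** * Passing to a localization and back *)

Section Localization.
Variables (R : comNzRingType) (m : R -> Prop).
Variables (A : comNzRingType) (phi : {rmorphism R -> A}).
Hypothesis phi_loc : is_localization_at m phi.
Hypothesis m'1 : ~ m 1.
Hypothesis m'M : forall s t, ~ m s -> ~ m t -> ~ m (s * t).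

Lemma localization_cancel s (x y : A) : ~ m s -> x * phi s = y * phi s -> x = y.
Proof.
case: phi_loc => inv _ _ /inv[t st] xy.
by rewrite -[x]mulr1 -[y]mulr1 -st !mulrA xy.
Qed.

Lemma m'_prod n (s : 'I_n -> R) (P : pred 'I_n) :
  (forall i, ~ m (s i)) -> ~ m (\prod_(i | P i) s i).
Proof.
by move=> ms; apply: (big_ind (fun x => ~ m x)) => // x y; apply: m'M.
Qed.

Lemma common_denominator n (a : 'I_n -> A) :
  exists s (r : 'I_n -> R), ~ m s /\ forall i, a i * phi s = phi (r i).
Proof.
case: phi_loc => _ frac _.
have /choice[r /choice[s srE]] := fun i => frac (a i).
have ms i : ~ m (s i) by have [] := srE i.
exists (\prod_i s i), (fun i => r i * \prod_(j | j != i) s j).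
split=> [|i]; first exact: m'_prod.
rewrite (bigD1 i) //= !rmorphM mulrA; congr (_ * _).
by have [] := srE i.
Qed.

Variables (n : nat) (v : R) (l : 'I_n -> R) (w : 'I_n).
Hypothesis vl0 : forall i, v * l i = 0.
Hypothesis v_reduced : forall b, v ^+ 2 * b = 0 -> v * b = 0.
Hypothesis annv : forall b, v * b = 0 -> in_span l b.
Hypothesis syzygy_w :
  forall a, syzygy l a -> exists b, v * a w = v ^+ 2 * b.

Let lA i := phi (l i).

(** This and the next two facts transfer the hypotheses to [A]: clear denominators, multiply by an
    element outside [m] to get an identity in [R], then divide again. *)
Let v_reducedA b : phi v ^+ 2 * b = 0 -> phi v * b = 0.
Proof.
case: phi_loc => _ /(_ b)[r [s [ms bE]]] ker vb.
have /ker[t [mt tE]] : phi (v ^+ 2 * r) = 0.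
  by rewrite rmorphM rmorphXn -bE mulrA vb mul0r.
apply: (localization_cancel mt); apply: (localization_cancel ms).
have E : v * (t * r) = 0 by apply: v_reduced; rewrite mulrCA.
rewrite !mul0r [LHS](_ : _ = phi v * (phi t * (b * phi s))); last by ring.
by rewrite bE -!rmorphM E rmorph0.
Qed.

Let annvA b : phi v * b = 0 -> in_span lA b.
Proof.
case: phi_loc => inv /(_ b)[r [s [ms bE]]] ker vb.
have /ker[t [mt tE]] : phi (v * r) = 0 by rewrite rmorphM -bE mulrA vb mul0r.
have /annv[a aE] : v * (t * r) = 0 by rewrite mulrCA.
have [x xE] := inv _ (m'M ms mt).
exists [ffun i => phi (a i) * x].
transitivity (phi (t * r) * x).
  by rewrite -[LHS]mulr1 -xE !rmorphM mulrA (mulrA b) bE (mulrC (phi r)).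
rewrite aE rmorph_sum mulr_suml; apply: eq_bigr => i _.
by rewrite ffunE rmorphM mulrAC.
Qed.

Let syzygy_wA a : syzygy lA a -> exists b, phi v * a w = phi v ^+ 2 * b.
Proof.
case: (phi_loc) => inv _ ker sa.
have [s [r [ms aE]]] := common_denominator a.
have /ker[t [mt tE]] : phi (\sum_i r i * l i) = 0.
  rewrite rmorph_sum -[RHS](mul0r (phi s)) -[X in X * _]sa mulr_suml.
  by apply: eq_bigr => i _; rewrite rmorphM -aE mulrAC.
have [|b] := syzygy_w (a := [ffun i => t * r i]).
  rewrite /syzygy -[RHS]tE mulr_sumr; apply: eq_bigr => i _.
  by rewrite ffunE mulrA.
rewrite ffunE => bE; have [x xE] := inv _ (m'M ms mt).
exists (phi b * x); rewrite mulrA -rmorphXn -rmorphM -bE !rmorphM -aE.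
by rewrite -[LHS]mulr1 -xE !rmorphM; ring.
Qed.

(** The fractions [c / s] and [d / s] are the coefficients [C w] and [C u] of the projection to
    [(v)]; [t] absorbs the kernel of [phi]. *)
Lemma finite_injective_dimension_localization u :
  finite_injective_dimension A^o -> u != w ->
  exists s t c d, [/\ ~ m s, ~ m t, t * (v * (c - s)) = 0 &
                      t * (l u * c - l w * d) = 0].
Proof.
move=> fid uw.
have [|C CE] := finite_injective_dimension_syzygy
  _ v_reducedA annvA syzygy_wA fid.
  by move=> i; rewrite -rmorphM vl0 rmorph0.
have sum1 (x : A) (i : 'I_n) (f : 'I_n -> A) :
    \sum_j (if j == i then x else 0) * f j = x * f i.
  rewrite (bigD1 i) //= eqxx big1 ?addr0 // => j /negPf ->.
  by rewrite mul0r.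
(* The syzygy [v e_w], whose quotient is [b = 1]. *)
have vC : phi v = phi v * C w.
  pose a : {ffun 'I_n -> A^o} := [ffun j => if j == w then phi v else 0].
  have aE f : \sum_j a j * f j = phi v * f w.
    by rewrite -sum1; apply: eq_bigr => j _; rewrite ffunE.
  rewrite -aE -(CE a 1) ?mulr1 //.
    by rewrite /syzygy aE -rmorphM vl0 rmorph0.
  by rewrite ffunE eqxx expr2.
(* A Koszul syzygy; [v * l u = 0] gives the quotient [b = 0]. *)
have lC : lA u * C w - lA w * C u = 0.
  pose a : {ffun 'I_n -> A^o} := [ffun j =>
    (if j == w then lA u else 0) - (if j == u then lA w else 0)].
  have aE f : \sum_j a j * f j = lA u * f w - lA w * f u.
    rewrite -!sum1 -sumrB; apply: eq_bigr => j _.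
    by rewrite ffunE mulrBl.
  rewrite -aE -(CE a 0) ?mulr0 //; first by rewrite /syzygy aE mulrC subrr.
  by rewrite ffunE eqxx eq_sym (negPf uw) subr0 -rmorphM vl0 rmorph0.
have [s [r [ms rE]]] := common_denominator C.
case: phi_loc => _ _ ker.
have /ker[t1 [mt1 t1E]] : phi (v * (r w - s)) = 0.
  by rewrite rmorphM rmorphB -rE mulrBr mulrA -vC subrr.
have /ker[t2 [mt2 t2E]] : phi (l u * r w - l w * r u) = 0.
  by rewrite rmorphB !rmorphM -!rE !mulrA -mulrBl lC mul0r.
exists s, (t1 * t2), (r w), (r u); split=> //; first exact: m'M.
  by rewrite mulrAC t1E mul0r.
by rewrite -mulrA t2E mulr0.
Qed.

End Localization.

(** * Monomials in the edge ideal and in its quotient ring *)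

Lemma mcoeffMXE n (R : nzRingType) (p : {mpoly R[n]}) (a m : 'X_{1..n}) :
  (p * 'X_[a])@_m = if (a <= m)%MM then p@_(m - a) else 0.
Proof.
case: ifP => [am|/negP am]; first by rewrite -{1}(submK am) addmC mcoeffMX.
rewrite mcoeffM big1 // => b /eqP mE; rewrite mcoeffX; case: eqP => [aE|].
  by case: am; rewrite mE aE lem_addl.
by rewrite mulr0.
Qed.

Lemma mcoeff0M n (R : nzRingType) (p q : {mpoly R[n]}) :
  (p * q)@_0 = p@_0 * q@_0.
Proof. exact: (rmorphM (mcoeff 0%MM)). Qed.

Section EdgeRing.
Variables (k : fieldType) (n : nat) (e : rel 'I_n).
Hypotheses (e_sym : ssrbool.symmetric e) (e_irr : irreflexive e).

Definition has_edge (m : 'X_{1..n}) : bool :=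
  [exists i, exists j, [&& e i j, (0 < m i)%N & (0 < m j)%N]].

Lemma has_edgeP (m : 'X_{1..n}) :
  reflect (exists i j, [/\ e i j, (0 < m i)%N & (0 < m j)%N]) (has_edge m).
Proof.
apply: (iffP existsP) => [[i /existsP[j /and3P[]]]|[i [j [eij mi mj]]]].
  by exists i, j.
by exists i; apply/existsP; exists j; rewrite eij mi mj.
Qed.

Lemma has_edge_supp (m1 m2 : 'X_{1..n}) :
  (forall i, (0 < m1 i)%N -> (0 < m2 i)%N) -> has_edge m1 -> has_edge m2.
Proof.
move=> m12 /has_edgeP[i [j [eij mi mj]]]; apply/has_edgeP; exists i, j.
by split=> //; apply: m12.
Qed.

Lemma edge_neq i j : e i j -> i != j.
Proof. by apply: contraTneq => ->; rewrite e_irr. Qed.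

Lemma edge_lem i j (m : 'X_{1..n}) : e i j ->
  (U_(i) + U_(j) <= m)%MM = (0 < m i)%N && (0 < m j)%N.
Proof.
move=> eij; apply/mnm_lepP/andP => [H|[mi mj] a].
  by split; [apply: leq_trans (H i)|apply: leq_trans (H j)];
    rewrite mnmDE !mnm1E eqxx ?addn1.
rewrite mnmDE !mnm1E; have := edge_neq eij.
case: (eqVneq i a) => [ia|_]; case: (eqVneq j a) => [ja|_] //.
- by rewrite ia ja eqxx.
- by rewrite -ia.
- by rewrite -ja.
Qed.

Lemma edge_monomialX i j (m : 'X_{1..n}) :
  e i j -> (0 < m i)%N -> (0 < m j)%N ->
  'X_[m] = 'X_[m - (U_(i) + U_(j))] * ('X_i * 'X_j) :> {mpoly k[n]}.
Proof.
move=> eij mi mj; rewrite -!mpolyXD submK //.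
by rewrite edge_lem // mi mj.
Qed.

(** The ideal is monomial, so membership is tested on each monomial separately and becomes a
    question about supports. *)
Lemma edge_idealE (f : {mpoly k[n]}) :
  f \in edge_ideal k e <-> forall m, f@_m != 0 -> has_edge m.
Proof.
split=> [/edge_idealP[s [sE ->]] m|fm].
  apply: contraNT => nm; rewrite raddf_sum big1_seq //=.
  move=> c /sE[i [j [eij ->]]].
  rewrite -mpolyXD mcoeffMXE edge_lem //; case: ifP => // /andP[mi mj].
  by case/has_edgeP: nm; exists i, j.
rewrite (mpolyE f) big_seq; apply: rpred_sum => m; rewrite mcoeff_msupp => /fm.
case/has_edgeP => i [j [eij mi mj]]; apply/edge_idealP.
exists [:: (f@_m *: 'X_[m - (U_(i) + U_(j))], 'X_i * 'X_j)]; split.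
  by move=> c; rewrite inE => /eqP -> /=; exists i, j.
by rewrite big_seq1 /= -scalerAl -edge_monomialX.
Qed.

Lemma mem_edge_idealX (m : 'X_{1..n}) :
  ('X_[m] \in edge_ideal k e) = has_edge m.
Proof.
apply/idP/idP => [/edge_idealE/(_ m)|me].
  by rewrite mcoeffX eqxx oner_eq0; apply.
apply/edge_idealE => m'; rewrite mcoeffX; have [<- //|_] := eqVneq m m'.
by rewrite eqxx.
Qed.

Definition edge_proj : {rmorphism {mpoly k[n]} -> edge_ideal_quotient k e} :=
  \pi_(edge_ideal_quotient k e)%qT.

Lemma edge_proj_eq0 f : edge_proj f = 0 <-> f \in edge_ideal k e.
Proof.
rewrite -{2}[f]subr0.
rewrite (Quotient.idealrBE (edge_ideal k e : idealr {mpoly k[n]})).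
by rewrite -(rmorph0 edge_proj); split=> /eqP.
Qed.

Lemma edge_projX_eq0 m : has_edge m -> edge_proj 'X_[m] = 0.
Proof. by move=> me; apply/edge_proj_eq0; rewrite mem_edge_idealX. Qed.

Lemma edge_proj_surj x : exists f, edge_proj f = x.
Proof. by exists (repr x); apply: reprK. Qed.

Lemma edge_ideal_coef0 f : edge_proj f = 0 -> f@_0 = 0.
Proof.
move=> /edge_proj_eq0/edge_idealE/(_ 0%MM) f0; apply/eqP.
apply: contraT => /f0/has_edgeP[i [j []]].
by rewrite mnm0E.
Qed.

(** The two ends of an edge differ, so no edge monomial divides a single variable. *)
Lemma edge_ideal_coef1 f i : edge_proj f = 0 -> f@_U_(i) = 0.
Proof.
move=> /edge_proj_eq0/edge_idealE/(_ U_(i)%MM) f0; apply/eqP.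
apply: contraT => /f0/has_edgeP[a [b [/edge_neq]]].
rewrite !mnm1E; case: (eqVneq i a) => [<-|//].
by case: (eqVneq i b) => // _ _ [].
Qed.

Definition origin_ideal (x : edge_ideal_quotient k e) : Prop :=
  exists2 f, edge_proj f = x & f@_0 = 0.

Lemma origin_idealE f : origin_ideal (edge_proj f) <-> f@_0 = 0.
Proof.
split=> [[g gf g0]|]; last by exists f.
have /edge_ideal_coef0 : edge_proj (f - g) = 0 by rewrite rmorphB gf subrr.
by rewrite mcoeffB g0 subr0.
Qed.

Lemma origin_ideal1 : ~ origin_ideal 1.
Proof.
rewrite -(rmorph1 edge_proj) => /origin_idealE/eqP.
by rewrite mcoeff1 eqxx oner_eq0.
Qed.

Lemma origin_idealM s t :
  ~ origin_ideal s -> ~ origin_ideal t -> ~ origin_ideal (s * t).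
Proof.
have [f <-] := edge_proj_surj s; have [g <-] := edge_proj_surj t.
rewrite -rmorphM; move=> f0 g0 /origin_idealE/eqP.
by rewrite mcoeff0M mulf_eq0 => /orP[]/eqP/origin_idealE.
Qed.

Lemma origin_ideal_maximal : maximal_ideal origin_ideal.
Proof.
split; [split| exact: origin_ideal1 |].
- by rewrite -(rmorph0 edge_proj); apply/origin_idealE; rewrite mcoeff0.
- move=> _ _ [f <- f0] [g <- g0]; rewrite -rmorphD; apply/origin_idealE.
  by rewrite mcoeffD f0 g0 addr0.
- move=> a _ [f <- f0]; have [g <-] := edge_proj_surj a.
  by rewrite -rmorphM; apply/origin_idealE; rewrite mcoeff0M f0 mulr0.
move=> J [J0 JD JM] mJ nJ1 x; have [f <-] := edge_proj_surj x => Jf.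
apply/origin_idealE/eqP; apply: contra_notT nJ1 => f0.
(* Adding an element of the origin ideal turns [f] into its constant term, which is invertible. *)
have -> : 1 = edge_proj (f@_0%MM)^-1%:MP *
    (edge_proj f + edge_proj ((f@_0%MM)%:MP - f)).
  rewrite -rmorphD addrCA subrr addr0 -rmorphM -mpolyCM mulVf //.
  by rewrite mpolyC1 rmorph1.
apply: JM; apply: JD => //; apply: mJ; apply/origin_idealE.
by rewrite mcoeffB mcoeffC eqxx mulr1 subrr.
Qed.

(** * A leaf [w] attached to [v] *)

Section Leaf.
Variables v w : 'I_n.
Hypotheses (e_vw : e v w) (w_leaf : forall j, e w j -> j = v).

Let y i := edge_proj 'X_i.
(** Zeros off the neighbourhood of [v] allow indexing by all vertices and leave the generated ideal
    unchanged. *)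
Let l i := if e v i then y i else 0.

Let yX m : edge_proj 'X_[m + U_(v)] = y v * edge_proj 'X_[m].
Proof. by rewrite mpolyXD rmorphM mulrC. Qed.

Let vl0 i : y v * l i = 0.
Proof.
rewrite /l; case: ifP => [evi|_]; last by rewrite mulr0.
rewrite /y -rmorphM -mpolyXD edge_projX_eq0 //; apply/has_edgeP; exists v, i.
by rewrite evi !mnmDE !mnm1E !eqxx addn1.
Qed.

(** Edge ideals are squarefree: multiplying by [v] twice gives the same support as once. *)
Let v_reduced b : y v ^+ 2 * b = 0 -> y v * b = 0.
Proof.
have [f <-] := edge_proj_surj b.
rewrite /y -rmorphXn -!rmorphM => /edge_proj_eq0/edge_idealE f2.
apply/edge_proj_eq0/edge_idealE => m; rewrite mulrC mcoeffMXE.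
case: ifP => [vm|]; last by rewrite eqxx.
rewrite -(mcoeffMX f (U_(v) + U_(v))%MM) mpolyXD -expr2 mulrC => /f2.
apply: has_edge_supp => i; rewrite -addmA (addmC _ (m - _)%MM) submK //.
rewrite mnmDE mnm1E; case: eqP => [<- _|//].
by have /mnm_lepP/(_ v) := vm; rewrite mnm1E eqxx.
Qed.

Let annv b : y v * b = 0 -> in_span l b.
Proof.
have [f <-] := edge_proj_surj b.
rewrite /y -rmorphM mulrC => /edge_proj_eq0/edge_idealE fv.
rewrite (mpolyE f) rmorph_sum big_seq.
apply: big_ind => [|a c Ha Hc|m].
- exact: in_span0.
- by have := in_spanZD 1 Ha Hc; rewrite scale1r.
rewrite mcoeff_msupp => fm.
have /fv/has_edgeP mE : (f * 'X_v)@_(U_(v) + m) != 0 by rewrite mcoeffMX.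
have [me|nm] := boolP (has_edge m).
  by rewrite -mul_mpolyC rmorphM edge_projX_eq0 // mulr0; apply: in_span0.
(* Since [m] holds no edge but [m + U_(v)] does, that edge joins [v] to a vertex of [m]. *)
have [j evj mj] : exists2 j, e v j & (0 < m j)%N.
  apply: contraNP nm => nv; apply/has_edgeP; case: mE => i [j [eij]].
  rewrite !mnmDE !mnm1E => mi mj; exists i, j; split=> //.
    case: eqP mi => // vi _; case: nv; exists j; first by rewrite vi.
    by move: mj; rewrite vi (negPf (edge_neq eij)).
  case: eqP mj => // vj _; case: nv; exists i; first by rewrite vj e_sym.
  by move: mi; rewrite vj eq_sym (negPf (edge_neq eij)).
exists [ffun i => if i == j then
  edge_proj (f@_m *: 'X_[m - U_(j)]) else 0].
rewrite (bigD1 j) //= ffunE eqxx big1 => [|i /negPf ij]; last first.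
  by rewrite ffunE ij mul0r.
rewrite addr0 /l evj -rmorphM -scalerAl -mpolyXD submK //.
by apply/mnm_lepP => i; rewrite mnm1E; case: eqP => // <-.
Qed.

(** Argue on each monomial [m] of [a w]: either [v] divides it, which supplies the second factor
    [v], or the leaf condition forces [v m] into the edge ideal. *)
Let syzygy_w a : syzygy l a -> exists b, y v * a w = y v ^+ 2 * b.
Proof.
have /choice[f fE] := fun i => edge_proj_surj (a i).
rewrite /syzygy (eq_bigr (fun i => edge_proj (f i * (e v i)%:R * 'X_i))).
  rewrite -rmorph_sum => /edge_proj_eq0/edge_idealE fl.
  rewrite -fE (mpolyE (f w)) rmorph_sum big_seq mulr_sumr.
  apply: (big_ind (fun x => exists b, x = y v ^+ 2 * b)).
  - by exists 0; rewrite mulr0.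
  - by move=> _ _ [b ->] [c ->]; exists (b + c); rewrite mulrDr.
  move=> m; rewrite mcoeff_msupp => fm.
  have [vm|mv] := boolP (U_(v) <= m)%MM.
    exists (edge_proj ((f w)@_m *: 'X_[m - U_(v)])).
    have := yX (m - U_(v))%MM; rewrite submK // -!mul_mpolyC !rmorphM => ->.
    by ring.
  exists 0; rewrite mulr0 -mul_mpolyC rmorphM mulrCA -yX.
  rewrite edge_projX_eq0 ?mulr0 //.
  have mv0 : m v = 0%N.
    apply/eqP; rewrite -leqn0 leqNgt; apply: contra mv => mv.
    by apply/mnm_lepP => i; rewrite mnm1E; case: eqP => // <-.
  apply: contraT => nmv.
  have mN i : e v i -> m i = 0%N.
    move=> evi; apply/eqP; rewrite -leqn0 leqNgt; apply: contra nmv => mi.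
    apply/has_edgeP; exists v, i; split=> //.
      by rewrite mnmDE mnm1E eqxx addn1.
    by rewrite mnmDE ltn_addr.
  (* Only the summand at [w] contributes: any other neighbour of [v] is absent from [m + U_(w)]. *)
  have /fl/has_edgeP : (\sum_i f i * (e v i)%:R * 'X_i)@_(m + U_(w)) != 0.
    rewrite raddf_sum (bigD1 w) //= e_vw mulr1 addmC mcoeffMX.
    rewrite big1 ?addr0 // => i iw.
    have [evi|_] := boolP (e v i); last by rewrite mulr0 mul0r mcoeff0.
    rewrite mulr1 mcoeffMXE ifF //; apply/negP => /mnm_lepP/(_ i).
    by rewrite mnmDE !mnm1E eqxx eq_sym (negPf iw) mN.
  case=> i [j]; rewrite !mnmDE !mnm1E => -[eij mi mj].
  have vw0 : (m v + (w == v) = 0)%N.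
    by rewrite mv0 eq_sym (negPf (edge_neq e_vw)).
  (* An edge at [w] would need [v], which is absent; an edge avoiding [w] already lies in [m],
     against [nmv]. *)
  have [wi|wi] := eqVneq w i.
    by move: mj; rewrite (w_leaf (j := j)) ?vw0 // wi.
  have [wj|wj] := eqVneq w j.
    by move: mi; rewrite (w_leaf (j := i)) ?vw0 // wj e_sym.
  case/negP: nmv; apply/has_edgeP; exists i, j; move: mi mj.
  by rewrite (negPf wi) (negPf wj) !addn0 !mnmDE => mi mj; rewrite !ltn_addr.
move=> i _; rewrite -fE /l; case: ifP => _.
  by rewrite mulr1 rmorphM.
by rewrite !mulr0 mul0r rmorph0.
Qed.

Lemma gorenstein_leaf u :
  gorenstein (edge_ideal_quotient k e) -> e v u -> u = w.
Proof.
case=> _ /(_ _ origin_ideal_maximal)[A [phi [loc fid]]] evu.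
apply/eqP; apply: contraT => uw.
have [s [t [c [d [ms mt]]]]] := finite_injective_dimension_localization
  loc origin_ideal1 origin_idealM vl0 v_reduced annv syzygy_w fid uw.
have mcoeffXU0 (p : {mpoly k[n]}) i : (p * 'X_i)@_U_(i) = p@_0.
  by have := mcoeffMX p U_(i) 0%MM; rewrite addm0.
rewrite /l evu e_vw /y; move: ms mt.
have [{}s <-] := edge_proj_surj s; have [{}t <-] := edge_proj_surj t.
have [{}c <-] := edge_proj_surj c; have [{}d <-] := edge_proj_surj d.
move=> /origin_idealE/eqP s0 /origin_idealE/eqP t0.
rewrite -!(rmorphB, rmorphM).
(* The coefficient of [v] shows that [c] and [s] have the same constant term, which is nonzero. *)
rewrite mulrCA mulrC => /(edge_ideal_coef1 v) /eqP.
rewrite mcoeffXU0 mcoeff0M mulf_eq0 (negPf t0) mcoeffB subr_eq0 /=.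
(* The coefficient of [u] forces the product of the nonzero constant terms of [t] and [s] to
   vanish. *)
move=> /eqP cs; rewrite mulrBr !(mulrC 'X__) !mulrA => /(edge_ideal_coef1 u).
rewrite mcoeffB mcoeffXU0 mcoeffMXE mcoeff0M cs lep1mP mnm1E (negPf uw).
by rewrite subr0 => /eqP; rewrite mulf_eq0 (negPf s0) (negPf t0).
Qed.

End Leaf.
End EdgeRing.

(** * The lcm lattice of an edge ideal *)

Lemma mlcm_nat n (a b : 'X_{1..n}) i : mlcm a b i = maxn (a i) (b i).
Proof. by rewrite mlcmE mnmDE mnmBE maxnE. Qed.

Lemma big_mlcm_lem n (s : seq 'X_{1..n}) (m : 'X_{1..n}) :
  (\big[@mlcm n/0%MM]_(g <- s) g <= m)%MM = all (fun g => (g <= m)%MM) s.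
Proof.
elim: s => [|g s IH].
  by rewrite big_nil; apply/mnm_lepP => i; rewrite mnm0E.
by rewrite big_cons lem_mlcm IH.
Qed.

Lemma lem_big_mlcm n (s : seq 'X_{1..n}) (g : 'X_{1..n}) :
  g \in s -> (g <= \big[@mlcm n/0%MM]_(h <- s) h)%MM.
Proof.
have /esym/allP := big_mlcm_lem s (\big[@mlcm n/0%MM]_(h <- s) h).
by rewrite lepm_refl; apply.
Qed.

Section Lattice.
Variables (k : fieldType) (n : nat) (e : rel 'I_n).
Hypotheses (e_sym : ssrbool.symmetric e) (e_irr : irreflexive e).

Let L := lcm_lattice (edge_ideal k e).

Lemma edge_generator g :
  minimal_monomial_generator (edge_ideal k e) g <->
  exists i j, e i j /\ g = (U_(i) + U_(j))%MM.
Proof.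
split=> [[]|[i [j [eij ->]]]].
  rewrite (mem_edge_idealX _ e_irr) => /has_edgeP[i [j [eij gi gj]]] gmin.
  exists i, j; split=> //; apply/esym/gmin; last first.
    by rewrite (edge_lem e_irr) // gi gj.
  rewrite (mem_edge_idealX _ e_irr); apply/has_edgeP; exists i, j.
  by rewrite !mnmDE !mnm1E !eqxx addn1.
split=> [|m].
  rewrite (mem_edge_idealX _ e_irr); apply/has_edgeP; exists i, j.
  by rewrite !mnmDE !mnm1E !eqxx addn1.
rewrite (mem_edge_idealX _ e_irr) => /has_edgeP[a [b [eab ma mb]]] mij.
have in_ij c : (0 < m c)%N -> (i == c) || (j == c).
  have /mnm_lepP/(_ c) := mij; rewrite mnmDE !mnm1E.
  by case: eqP => //= _; case: eqP => //= _; rewrite leqn0 => /eqP ->.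
have : (U_(i) + U_(j) <= m)%MM.
  rewrite (edge_lem e_irr) //.
  move: (in_ij _ ma) (in_ij _ mb) (edge_neq e_irr eab) (ma) (mb).
  by case/orP=> /eqP<- /orP[]/eqP<-; rewrite ?eqxx // => _ -> ->.
move=> ijm; apply/mnmP => c; apply/eqP; rewrite eqn_leq.
by move/mnm_lepP: ijm => -> ; move/mnm_lepP: mij => ->.
Qed.

Lemma lcm_lattice_le1 x i : L x -> (x i <= 1)%N.
Proof.
case=> s [sE ->].
have : (\big[@mlcm n/0%MM]_(g <- s) g <= [multinom 1%N | _ < n])%MM.
  rewrite big_mlcm_lem; apply/allP => g /sE/edge_generator[a [b [eab ->]]].
  by rewrite (edge_lem e_irr) // !mnmE.
by move/mnm_lepP/(_ i); rewrite mnmE.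
Qed.

Lemma lcm_lattice_supp x i :
  L x -> (0 < x i)%N -> exists2 j, e i j & (0 < x j)%N.
Proof.
case=> s [sE ->] xi.
have [g gs gi] : exists2 g : 'X_{1..n}, g \in s & (0 < g i)%N.
  elim: s {sE} xi => [|g s IH]; first by rewrite big_nil mnm0E.
  rewrite big_cons mlcm_nat leq_max => /orP[gi|/IH[h hs hi]].
    by exists g; rewrite ?mem_head.
  by exists h; rewrite // in_cons hs orbT.
have /sE/edge_generator[a [b [eab gE]]] := gs.
have := lem_big_mlcm gs; rewrite {1}gE (edge_lem e_irr) // => /andP[xa xb].
move: gi; rewrite gE mnmDE !mnm1E; case: (eqVneq a i) => [<- _|_].
  by exists b.
by case: (eqVneq b i) => [<- _|//]; exists a; rewrite // e_sym.
Qed.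

Definition indicator (P : pred 'I_n) : 'X_{1..n} :=
  [multinom (P i : nat) | i < n].

(** Such a [P] is the union of the edges inside it. With [lcm_lattice_le1] and [lcm_lattice_supp],
    this identifies the lattice with the vertex sets inducing no isolated vertex. *)
Lemma lcm_lattice_indicator (P : pred 'I_n) :
  (forall i, P i -> exists2 j, e i j & P j) -> L (indicator P).
Proof.
move=> PE.
pose s := [seq (U_(p.1) + U_(p.2))%MM |
             p <- enum [pred p : 'I_n * 'I_n | [&& e p.1 p.2, P p.1 & P p.2]]].
have sE g : g \in s ->
    exists i j, [/\ e i j, P i, P j & g = (U_(i) + U_(j))%MM].
  case/mapP => -[i j]; rewrite mem_enum inE /= => /and3P[eij Pi Pj] ->.
  by exists i, j.
exists s; split=> [g /sE[i [j [eij _ _ gE]]]|].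
  by apply/edge_generator; exists i, j.
apply/mnmP => i; apply/eqP; rewrite eqn_leq mnmE; apply/andP; split.
  have [Pi|//] := boolP (P i); have [j eij Pj] := PE i Pi.
  have : (U_(i) + U_(j))%MM \in s.
    by apply/mapP; exists (i, j); rewrite // mem_enum inE /= eij Pi Pj.
  by move/lem_big_mlcm; rewrite (edge_lem e_irr) // => /andP[].
have : (\big[@mlcm n/0%MM]_(g <- s) g <= indicator P)%MM.
  rewrite big_mlcm_lem; apply/allP => g /sE[a [b [eab Pa Pb ->]]].
  by rewrite (edge_lem e_irr) // !mnmE Pa Pb.
by move/mnm_lepP/(_ i); rewrite mnmE.
Qed.

Hypothesis e_nonisolated : forall i, exists j, e i j.

Let top := indicator predT.

Lemma lcm_lattice_top : is_top (@lem n) L top.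
Proof.
split=> [|x Lx]; last by apply/mnm_lepP => i; rewrite mnmE lcm_lattice_le1.
by apply: lcm_lattice_indicator => i _; have [j] := e_nonisolated i; exists j.
Qed.

(** When every degree is at least 2, deleting one vertex isolates no other, so each [c i] lies in
    the lattice. An element is the meet of the [c i] for the vertices [i] it omits. *)
Lemma coatomic_no_leaf :
  (forall i j, e i j -> exists2 j', j' != j & e i j') -> coatomic (@lem n) L.
Proof.
move=> noleaf x Lx.
pose c i := indicator (predC1 i).
have Lc i : L (c i).
  apply: lcm_lattice_indicator => a /= ai; have [b eab] := e_nonisolated a.
  have [bi|] := eqVneq b i; last by exists b.
  by have [b' b'b eab'] := noleaf _ _ eab; exists b'; rewrite //= -bi.
exists (fun y => exists2 i, x i = 0%N & y = c i) => [_ [i xi0 ->]|].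
  exists top; first exact: lcm_lattice_top.
  split=> //.
  - by case: lcm_lattice_top.
  - by case: lcm_lattice_top => _; apply.
  - by move/mnmP/(_ i); rewrite !mnmE /= eqxx.
  (* Between [c i] and [top] only the coordinate [i] is free, and it is 0 or 1. *)
  move=> z Lz /mnm_lepP cz /mnm_lepP zt.
  have zE j : j != i -> z j = 1%N.
    move=> ji; apply/eqP; rewrite eqn_leq lcm_lattice_le1 //=.
    by have := cz j; rewrite mnmE /= ji.
  case: (posnP (z i)) => zi; [left|right]; apply/mnmP => j; rewrite mnmE /=.
    by case: (eqVneq j i) => [->|/zE ->].
  case: (eqVneq j i) => [->|/zE -> //].
  by apply/eqP; rewrite eqn_leq zi lcm_lattice_le1.
split=> // [_ [i xi0 ->]|z Lz zc]; apply/mnm_lepP => j.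
  rewrite mnmE /=; case: (eqVneq j i) => [->|_]; first by rewrite xi0.
  exact: lcm_lattice_le1.
case: (posnP (x j)) => xj; last exact: leq_trans (lcm_lattice_le1 _ Lz) xj.
have /mnm_lepP/(_ j) := zc _ (ex_intro2 _ _ j xj erefl).
by rewrite mnmE /= eqxx leqn0 => /eqP ->.
Qed.

(** For a single edge the lattice has only the elements 0 and [top], so 0 is the coatom. *)
Lemma coatomic_edge v w :
  (forall j, e v j -> j = w) -> (forall j, e w j -> j = v) ->
  (forall i, i = v \/ i = w) -> coatomic (@lem n) L.
Proof.
move=> ev ew vw x Lx.
have L01 z : L z -> z = 0%MM \/ z = top.
  move=> Lz; have zvw : (0 < z v)%N = (0 < z w)%N.
    by apply/idP/idP => /(lcm_lattice_supp Lz)[j]; [move/ev|move/ew] => ->.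
  have zE i : (0 < z i)%N = (0 < z v)%N by case: (vw i) => ->.
  case: (posnP (z v)) => zv; [left|right]; apply/mnmP => i; rewrite mnmE.
    by apply/eqP; rewrite -leqn0 leqNgt zE zv.
  by apply/eqP; rewrite eqn_leq lcm_lattice_le1 // zE.
have L0 : L 0%MM by exists [::]; rewrite big_nil.
have Ltop : L top by case: lcm_lattice_top.
case: (L01 x Lx) => ->.
  exists (fun y => y = 0%MM) => [_ ->|].
    exists top; first exact: lcm_lattice_top.
    split=> //; first by apply/mnm_lepP => i; rewrite mnm0E.
      by move/mnmP/(_ v); rewrite mnm0E mnmE.
    by move=> z /L01.
  by split=> // [_ ->|z _ ->] //; apply: lepm_refl.
(* The top element is the empty meet. *)
exists (fun=> False) => //; split=> // z Lz _.
by case: lcm_lattice_top => _; apply.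
Qed.

End Lattice.

Theorem theorem7p3 (k : fieldType) (n : nat) (e : rel 'I_n)
    (e_sym : ssrbool.symmetric e) (e_irr : irreflexive e)
    (e_connected : forall i j : 'I_n, connect e i j)
    (e_nontrivial : exists i j : 'I_n, e i j) :
  gorenstein (edge_ideal_quotient k e) ->
  coatomic (@lem n) (lcm_lattice (edge_ideal k e)).
Proof.
move=> gor.
have noniso i : exists j, e i j.
  have [p [q epq]] := e_nontrivial; have [<-|ip] := eqVneq p i.
    by exists q.
  have /connectP[[|j s] /=] := e_connected i p.
    by move=> _ pi; rewrite pi eqxx in ip.
  by case/andP => eij _ _; exists j.
have [[v [w [evw wE]]]|nl] :=
    pselect (exists v w, e v w /\ forall j, e w j -> j = v).
  have vE u : e v u -> u = w by apply: gorenstein_leaf gor.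
  apply: (coatomic_edge e_sym e_irr noniso vE wE) => i.
  (* No edge leaves [{v, w}], so connectedness makes it the whole vertex set. *)
  have cl : closed e (pred2 v w).
    apply: intro_closed => [|a b eab]; first exact: sym_connect_sym.
    rewrite !inE => /orP[]/eqP aE; move: eab; rewrite aE.
      by move/vE => ->; rewrite eqxx orbT.
    by move/wE => ->; rewrite eqxx.
  have := closed_connect cl (e_connected v i).
  by rewrite !inE eqxx => /esym/orP[]/eqP; [left|right].
apply: coatomic_no_leaf => // i j eij.
have [[j' j'j eij']|nj] := pselect (exists2 j', j' != j & e i j').
  by exists j'.
(* If [j] were the only neighbour of [i], then [i] would be a leaf attached to [j]. *)
case: nl; exists j, i; split=> [|j' eij']; first by rewrite e_sym.
by apply/eqP; apply: contra_notT nj => j'j; exists j'.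
Qed.
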